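(* Let $\mathbb{A}$ be any set of allowable test processes. Let $I=[\underline{p},\overline{p}]\in\mathcal{I}$ be any closed subinterval of $[0,1]$ strictly included in $[0,1]$, so $\underline{p}>0$ or $\overline{p}<1$. Then the set of all paths $\omega\in\Omega$ that are $\mathbb{A}$-random for the stationary forecasting system $\gamma_I$ is meagre. Similarly, the set of all paths that are Schnorr random for $\gamma_I$ is meagre.
   Context: Notation: $\mathbb{N}=\{1,2,\dots\}$, $\mathbb{N}_0=\mathbb{N}\cup\{0\}$. Situations are the finite binary sequences $\mathbb{S}=\bigcup_{n\in\mathbb{N}_0}\{0,1\}^n$, with $\square$ the empty sequence; $sx$ is $s$ with $x\in\{0,1\}$ appended; $s\sqsubseteq t$ means that $s$ is a prefix of $t$. Paths are elements $\omega$ of $\Omega=\{0,1\}^{\mathbb{N}}$; $\omega_{1:n}\in\mathbb{S}$ consists of the first $n$ entries; $\Gamma(s)$ is the set of paths having $s$ as a prefix. $\mathcal{I}$ is the set of non-empty closed subintervals of $[0,1]$. A set $A\subseteq\Omega$ is nowhere dense if for every $s\in\mathbb{S}$ there is some $t\in\mathbb{S}$ with $s\sqsubseteq t$ and $A\cap\Gamma(t)=\emptyset$. A set $B\subseteq\Omega$ is meagre if it is a countable union of nowhere dense sets. For $f\colon\{0,1\}\to\mathbb{R}$ and $I\in\mathcal{I}$, $\overline{E}_I(f)=\max_{p\in I}[pf(1)+(1-p)f(0)]$. A forecasting system is a map $\varphi\colon\mathbb{S}\to\mathcal{I}$. For $I\in\mathcal{I}$, the stationary forecasting system $\gamma_I$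 is given by $\gamma_I(s)=I$ for all $s\in\mathbb{S}$. A real process is a map $F\colon\mathbb{S}\to\mathbb{R}$, with $\Delta F(s)(x)=F(sx)-F(s)$. A test process is a non-negative real process with $F(\square)=1$. A supermartingale for $\varphi$ is a real process $M$ with $\overline{E}_{\varphi(s)}(\Delta M(s))\le 0$ for all $s\in\mathbb{S}$; a test supermartingale for $\varphi$ is a test process that is a supermartingale for $\varphi$. Computability: ''recursive'' means computable by a Turing machine (countable sets such as $\mathbb{S}$ and $\mathbb{S}\times\mathbb{N}_0$ are identified with $\mathbb{N}_0$ by recursive bijections with recursive inverse). A real process $F$ is computable if there are a recursive family of rationals $r_{s,n}$ and a recursive map $e\colon\mathbb{S}\times\mathbb{N}_0\to\mathbb{N}_0$ such that $n\ge e(s,N)$ implies $|r_{s,n}-F(s)|\le 2^{-N}$. A set of allowable test processes is any countable set $\mathbb{A}$ of test processes that contains all computable (strictly) positive test processes. A path $\omega$ is $\mathbb{A}$-random for $\varphi$ if $\sup_{n\in\mathbb{N}}T(\omega_{1:n})<\infty$ for every $T\in\mathbb{A}$ that is a test supermartingale for $\varphi$. A growth function is a recursive, non-decreasing, unbounded map $\rho\colon\mathbb{N}_0\to\mathbb{N}_0$. A path $\omega$ is Schnorr random for $\varphi$ if $\limsup_{n\to\infty}[T(\omega_{1:n})-\rho(n)]\le 0$ for all computable test supermartingales $T$ for $\varphi$ and all growth functions $\rho$. *)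

(* Defs.v *)
From HB Require Import structures.
From mathcomp Require Import all_boot all_order all_algebra.
From mathcomp Require Import all_classical all_reals all_analysis.
From mathcomp Require Import ring.

Set Implicit Arguments.
Unset Strict Implicit.
Unset Printing Implicit Defensive.

Import Order.TTheory GRing.Theory Num.Theory.

Local Open Scope classical_set_scope.
Local Open Scope ring_scope.

(* Deterministic machines with one two-way infinite tape.  Input and output
   words use the letters 0, 1 and a separator; a machine may use finitely many
   auxiliary letters besides.  On the tape, [None] is the blank. *)

Inductive letter := Bit of bool | Sep.

Inductive direction := ToLeft | ToRight.

(* [tm_delta q a] is the new state, the letter written and the head move;
   it is [None] if the machine halts when reading [a] in state [q]. *)
Record turing_machine := TuringMachine {
  tm_state : finType;
  tm_aux : finType;
  tm_start : tm_state;
  tm_delta : tm_state -> option (letter + tm_aux) ->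
             option (tm_state * option (letter + tm_aux) * direction) }.

Section TuringMachines.
Variable M : turing_machine.

Definition tape_letter : Type := option (letter + tm_aux M).

(* [tape_left] lists the cells to the left of the head, nearest first;
   [tape_right] lists the scanned cell followed by the cells to its right.
   All the cells beyond these two lists are blank. *)
Record config := Config {
  cur_state : tm_state M;
  tape_left : seq tape_letter;
  tape_right : seq tape_letter }.

Definition tm_step (c : config) : option config :=
  let: Config q l r := c in
  match tm_delta q (head None r) with
  | None => None
  | Some (q', b, ToRight) => Some (Config q' (b :: l) (behead r))
  | Some (q', b, ToLeft) =>
      Some (Config q' (behead l) (head None l :: b :: behead r))
  end.

Fixpoint tm_run (k : nat) (c : config) : config :=
  if k is k'.+1 then
    if tm_step c is Some c' then tm_run k' c' else c
  else c.

Definition on_tape (w : seq letter) : seq tape_letter :=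
  [seq Some (inl a) | a <- w].

(* Started on the first letter of [w], the machine halts on the first letter
   of [v], with nothing else on the tape. *)
Definition tm_computes (w v : seq letter) : Prop :=
  exists k i j : nat, exists q : tm_state M,
    let c := Config q (nseq i None) (on_tape v ++ nseq j None) in
    tm_run k (Config (tm_start M) [::] (on_tape w)) = c /\ tm_step c = None.

End TuringMachines.

(* [false] and [true] stand for the outcomes 0 and 1; [rcons s x] is s
   followed by x. *)
Notation situation := (seq bool).

Definition code_nat (n : nat) : seq letter := nseq n (Bit true).

Definition code_situation_nat (sn : situation * nat) : seq letter :=
  [seq Bit x | x <- sn.1] ++ Sep :: code_nat sn.2.

Definition recursive (D : Type) (code : D -> seq letter) (f : D -> nat) :=
  exists M : turing_machine,
    forall d, tm_computes M (code d) (code_nat (f d)).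

Definition recursive_nat (f : nat -> nat) := recursive code_nat f.

Definition recursive_situation_nat (f : situation -> nat -> nat) :=
  recursive code_situation_nat (fun sn => f sn.1 sn.2).

(* Rationals are handled as (-1)^sigma a / b, with recursive sigma, a, b. *)
Definition recursive_rationals (r : situation -> nat -> rat) :=
  exists sigma a b : situation -> nat -> nat,
    [/\ recursive_situation_nat sigma, recursive_situation_nat a,
        recursive_situation_nat b, forall s n, (0 < b s n)%N
      & forall s n, r s n = (-1) ^+ sigma s n * (a s n)%:R / (b s n)%:R].

Definition growth_function (rho : nat -> nat) :=
  [/\ recursive_nat rho, {homo rho : m n / (m <= n)%N}
    & forall B, exists n, (B < rho n)%N].

(* The n-th entry of a path, for n >= 1, is [omega n.-1]. *)
Notation outcome_path := (nat -> bool).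

(* omega_{1:n} *)
Definition initial (omega : outcome_path) (n : nat) : situation := mkseq omega n.

Definition cylinder (s : situation) : set outcome_path :=
  [set omega | initial omega (size s) = s].

Definition nowhere_dense (A : set outcome_path) :=
  forall s : situation,
    exists2 t : situation, prefix s t & A `&` cylinder t = set0.

Definition meagre (B : set outcome_path) :=
  exists2 F : nat -> set outcome_path,
    forall k, nowhere_dense (F k) & B = \bigcup_k F k.

Section Randomness.
Variable R : realType.

Record interval01 := Interval01 {
  lo : R;
  hi : R;
  lo_ge0 : 0 <= lo;
  lo_le_hi : lo <= hi;
  hi_le1 : hi <= 1 }.

Definition points (I : interval01) : set R := `[lo I, hi I].

(* The supremum is a maximum, see [upper_expectation_max]. *)
Definition upper_expectation (I : interval01) (f : bool -> R) : R :=
  sup [set p * f true + (1 - p) * f false | p in points I].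

Lemma upper_expectation_max (I : interval01) (f : bool -> R) :
  exists2 p, points I p &
    upper_expectation I f = p * f true + (1 - p) * f false /\
    forall p', points I p' ->
      p' * f true + (1 - p') * f false <= p * f true + (1 - p) * f false.
Proof.
pose g p := p * f true + (1 - p) * f false.
have gB p p' : g p - g p' = (p - p') * (f true - f false).
  by rewrite /g; ring.
suff [p Ip pmax] : exists2 p, points I p & forall p', points I p' -> g p' <= g p.
  exists p => //; split=> //.
  apply/eqP; rewrite eq_le; apply/andP; split.
    by apply: ge_sup; [exists (g p), p | move=> _ [p' Ip' <-]; exact: pmax].
  apply: ub_le_sup; last by exists p.
  by exists (g p) => _ [p' Ip' <-]; exact: pmax.
have [f01|f10] := leP (f false) (f true).
  exists (hi I); first by rewrite /points /= in_itv /= lexx lo_le_hi.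
  move=> p'; rewrite /points /= in_itv /= => /andP[_ p'I].
  by rewrite -subr_ge0 gB mulr_ge0 // subr_ge0.
exists (lo I); first by rewrite /points /= in_itv /= lexx lo_le_hi.
move=> p'; rewrite /points /= in_itv /= => /andP[p'I _].
by rewrite -subr_ge0 gB mulr_le0 // subr_le0 // ltW.
Qed.

Definition forecasting_system := situation -> interval01.

Definition stationary (I : interval01) : forecasting_system := fun=> I.

Definition real_process := situation -> R.

Definition process_difference (F : real_process) (s : situation) : bool -> R :=
  fun x => F (rcons s x) - F s.

Definition test_process (F : real_process) :=
  (forall s, 0 <= F s) /\ F [::] = 1.

Definition positive_process (F : real_process) := forall s, 0 < F s.

Definition supermartingale (phi : forecasting_system) (M : real_process) :=
  forall s, upper_expectation (phi s) (process_difference M s) <= 0.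

Definition test_supermartingale (phi : forecasting_system) (M : real_process) :=
  test_process M /\ supermartingale phi M.

Definition computable_process (F : real_process) :=
  exists r : situation -> nat -> rat, exists e : situation -> nat -> nat,
    [/\ recursive_rationals r, recursive_situation_nat e
      & forall s N n, (e s N <= n)%N -> `|ratr (r s n) - F s| <= 2 ^- N].

Definition allowable (A : set real_process) :=
  [/\ countable A, forall T, A T -> test_process T
    & forall T, computable_process T -> positive_process T -> test_process T ->
        A T].

Definition allowably_random (A : set real_process) (phi : forecasting_system)
    (omega : outcome_path) :=
  forall T, A T -> test_supermartingale phi T ->
    (ereal_sup [set (T (initial omega n))%:E | n in [set n | (0 < n)%N]]
       < +oo)%E.

Definition schnorr_random (phi : forecasting_system) (omega : outcome_path) :=
  forall (T : real_process) (rho : nat -> nat),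
    computable_process T -> test_supermartingale phi T ->
    growth_function rho ->
    (limn_esup (fun n => (T (initial omega n) - (rho n)%:R)%:E) <= 0)%E.

End Randomness.

(* Main.v *)
(* One of the outcomes y = 1, 0 has all its probabilities bounded away from 1
   on I.  For K large enough, multiplying the capital by 1 + 1/K at each y and by
   1/K at each other outcome is then a computable positive test supermartingale
   T for the stationary system, which grows exponentially along a run of y's.
   So every situation can be extended to one where T exceeds any given linear
   function of the length: the paths along which T (omega_{1:n}) <= n + k for
   all n >= k form a nowhere dense set, and every random path belongs to one of
   these sets, in the Schnorr case because the identity is a growth function.

   T s is a quotient of two products over the entries of s.  Such a product
   counts the states of an odometer with one digit per entry, so a machine
   computes it in unary by running this odometer on its tape. *)

Require Import Defs.
From HB Require Import structures.
From mathcomp Require Import all_boot all_order all_algebra.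
From mathcomp Require Import all_classical all_reals all_analysis.
From mathcomp Require Import ring zify.

Set Implicit Arguments.
Unset Strict Implicit.
Unset Printing Implicit Defensive.

Import Order.TTheory GRing.Theory Num.Theory.

Local Open Scope classical_set_scope.
Local Open Scope ring_scope.

(** * Reachability of configurations, and two elementary machines *)

Definition tm_reach (M : turing_machine) (c c' : config M) :=
  exists k, tm_run k c = c'.

Lemma tm_reach_refl M (c : config M) : tm_reach c c.
Proof. by exists 0%N. Qed.

Lemma tm_reach_step M (c c1 c2 : config M) :
  tm_step c = Some c1 -> tm_reach c1 c2 -> tm_reach c c2.
Proof. by move=> cc1 [k <-]; exists k.+1; rewrite /= cc1. Qed.

Lemma tm_run_halted M (c : config M) k : tm_step c = None -> tm_run k c = c.
Proof. by case: k => //= k ->. Qed.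

Lemma tm_reach_trans M (c1 c2 c3 : config M) :
  tm_reach c1 c2 -> tm_reach c2 c3 -> tm_reach c1 c3.
Proof.
move=> [k <-] [l <-]; exists (k + l)%N.
elim: k c1 => //= k IHk c1.
by case: (tm_step c1) (@tm_run_halted M c1) => [c|->].
Qed.

Definition identity_machine : turing_machine :=
  @TuringMachine unit void tt (fun _ _ => None).

Lemma recursive_nat_id : recursive_nat id.
Proof.
exists identity_machine => n; exists 0%N, 0%N, 0%N, tt.
by rewrite /= cats0.
Qed.

Definition erasing_machine : turing_machine :=
  @TuringMachine unit void tt
    (fun _ a => if a is Some _ then Some (tt, None, ToRight) else None).

(** Since 0 is coded by the empty word, it suffices to erase the input. This provides both the sign
    exponent and the modulus of convergence of the betting process. *)
Lemma recursive_situation_nat0 : recursive_situation_nat (fun _ _ => 0%N).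
Proof.
exists erasing_machine => d; rewrite /tm_computes /=.
move: (code_situation_nat d) => w.
have erase i : tm_reach
    (@Config erasing_machine tt (nseq i None) (on_tape erasing_machine w))
    (@Config erasing_machine tt (nseq (i + size w) None) [::]).
  elim: w i => [|a w IHw] i; first by rewrite addn0; exact: tm_reach_refl.
  apply: tm_reach_step; first reflexivity.
  by rewrite addnS -addSn; exact: (IHw i.+1).
by have [k runk] := erase 0%N; exists k, (size w), 0%N, tt.
Qed.

(** * Products over a situation, computed in unary by an odometer *)

Inductive odometer_state := ReadBits | ReadRest | Borrow | Append | Erase.

Definition odometer_state_code (q : odometer_state) : 'I_5 :=
  match q with
  | ReadBits => inord 0 | ReadRest => inord 1 | Borrow => inord 2
  | Append => inord 3 | Erase => inord 4
  end.

Definition odometer_state_decode (i : 'I_5) : odometer_state :=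
  nth ReadBits [:: ReadBits; ReadRest; Borrow; Append; Erase] i.

Lemma odometer_state_codeK :
  cancel odometer_state_code odometer_state_decode.
Proof. by case; rewrite /odometer_state_decode /= inordK. Qed.

HB.instance Definition _ := Finite.copy odometer_state
  (can_type odometer_state_codeK).

Section Odometer.
Variables (C : nat) (radix : bool -> 'I_C.+1).

(* A digit [(d, r)] has current value [d] and is reset to [r] on a borrow, so
   its radix is [r.+1]. *)
Definition digit : finType := ('I_C.+1 * 'I_C.+1)%type.

Let cell : Type := option (letter + digit).

(* The separator and the letters after it become digits of radix 1, which leave
   the product of the radices unchanged. *)
Definition odometer_delta (q : odometer_state) (a : cell) :
    option (odometer_state * cell * direction) :=
  let fresh r : cell := Some (inr (r, r)) in
  let mark : cell := Some (inl (Bit true)) in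
  match q, a with
  | ReadBits, Some (inl (Bit x)) => Some (ReadBits, fresh (radix x), ToRight)
  | ReadBits, _ => Some (ReadRest, fresh ord0, ToRight)
  | ReadRest, Some _ => Some (ReadRest, fresh ord0, ToRight)
  | ReadRest, None | Append, None => Some (Borrow, mark, ToLeft)
  | Borrow, Some (inl _) => Some (Borrow, a, ToLeft)
  | Borrow, Some (inr (d, r)) =>
      if d == ord0 then Some (Borrow, fresh r, ToLeft)
      else Some (Append, Some (inr (inord d.-1, r)), ToRight)
  | Borrow, None => Some (Erase, None, ToRight)
  | Append, Some _ => Some (Append, a, ToRight)
  | Erase, Some (inr _) => Some (Erase, None, ToRight)
  | Erase, _ => None
  end.

Definition odometer : turing_machine :=
  @TuringMachine odometer_state digit ReadBits odometer_delta.

Let state (q : odometer_state) : tm_state odometer := q.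
Let mark : tape_letter odometer := Some (inl (Bit true)).
Let fresh (r : 'I_C.+1) : tape_letter odometer := Some (inr (r, r)).
(** The head has just moved left in state [Borrow], and now scans the nearest cell of [l], or a
    blank if [l] is empty. *)
Let after_left (l r : seq (tape_letter odometer)) : config odometer :=
  Config (state Borrow) (behead l) (head None l :: r).

Lemma odometer_borrow_marks k l r :
  tm_reach (after_left (nseq k mark ++ l) r) (after_left l (nseq k mark ++ r)).
Proof.
elim: k r => [|k IHk] r; first exact: tm_reach_refl.
apply: tm_reach_step; first reflexivity.
have -> : nseq k.+1 mark ++ r = nseq k mark ++ (mark :: r).
  by rewrite -addn1 nseqD -catA.
exact: IHk.
Qed.

Lemma odometer_append l r :
  all isSome r ->
  tm_reach (Config (state Append) l r) (after_left (rev r ++ l) [:: mark]).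
Proof.
elim: r l => [|[a|] r IHr] l //= rP; last first.
  apply: tm_reach_step; first reflexivity.
  by rewrite rev_cons cat_rcons; exact: IHr.
by apply: tm_reach_step; [reflexivity|exact: tm_reach_refl].
Qed.

(* Between two overflows of the digits [D], the machine borrows from them
   [\prod_(r <- D) r.+1] times, the last time unsuccessfully. *)
Lemma odometer_count (D : seq 'I_C.+1) l k :
  tm_reach (after_left (rev (map fresh D) ++ l) (nseq k mark))
    (after_left l (map fresh D ++ nseq (k + (\prod_(r <- D) r.+1).-1) mark)).
Proof.
elim: D l k => [|r D IHD] l k.
  by rewrite big_nil addn0; exact: tm_reach_refl.
rewrite big_cons /= rev_cons cat_rcons.
set P := (\prod_(j <- D) j.+1)%N in IHD *.
have P_gt0 : (0 < P)%N by apply: prodn_gt0.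
(* The leading digit is the most significant one. Each of its values [d], ..., 0 lasts for the [P]
   borrows that exhaust [D]. Every borrow but the last adds a mark. *)
suff count (d : nat) : (d <= r)%N -> forall k, tm_reach
    (after_left (rev (map fresh D) ++ Some (inr (inord d, r)) :: l) (nseq k mark))
    (after_left l (fresh r :: map fresh D ++ nseq (k + (d.+1 * P).-1) mark)).
  by have := count r (leqnn r) k; rewrite inord_val.
elim: d => [_|d IHd dr] {}k; apply: tm_reach_trans (IHD _ _) _.
  rewrite mul1n.
  apply: tm_reach_step (tm_reach_refl _) => /=.
  by rewrite (_ : inord 0 == ord0) //; apply/eqP/val_inj; rewrite /= inordK.
have dC : (d.+1 < C.+1)%N := leq_ltn_trans dr (ltn_ord r).
have stepE : tm_step (after_left (Some (inr (inord d.+1, r)) :: l)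
      (map fresh D ++ nseq (k + P.-1) mark)) =
    Some (Config (state Append) (Some (inr (inord d, r)) :: l)
      (map fresh D ++ nseq (k + P.-1) mark)).
  rewrite /= (_ : inord d.+1 == ord0 = false) ?inordK//.
  by apply/negbTE/eqP => /(congr1 val); rewrite /= inordK.
apply: tm_reach_step stepE _.
apply: tm_reach_trans (odometer_append _ _) _.
  by rewrite all_cat all_map all_nseq orbT andbT; apply/allP.
rewrite rev_cat rev_nseq -catA.
apply: tm_reach_trans (odometer_borrow_marks _ _ _) _.
have -> : nseq (k + P.-1) mark ++ [:: mark] = nseq (k + P) mark.
  by rewrite -[[:: mark]]/(nseq 1 mark) -nseqD -addnA addn1 prednK.
have -> : (k + (d.+2 * P).-1 = k + P + (d.+1 * P).-1)%N.
  rewrite [(d.+2 * P)%N]mulSn.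
  by case: (d.+1 * P)%N (muln_gt0 d.+1 P) => [|j _]; rewrite ?P_gt0// addnS addnA.
exact: IHd (ltnW dr) _.
Qed.

Lemma odometer_read_bits s l r :
  tm_reach (Config (state ReadBits) l (on_tape odometer (map Bit s) ++ r))
    (Config (state ReadBits) (rev (map fresh (map radix s)) ++ l) r).
Proof.
elim: s l => [|x s IHs] l; first exact: tm_reach_refl.
by apply: tm_reach_step; [reflexivity|rewrite /= rev_cons cat_rcons; exact: IHs].
Qed.

Lemma odometer_read_rest n l :
  tm_reach (Config (state ReadRest) l (on_tape odometer (code_nat n)))
    (after_left (rev (map fresh (nseq n ord0)) ++ l) [:: mark]).
Proof.
elim: n l => [|n IHn] l.
  by apply: tm_reach_step; [reflexivity|exact: tm_reach_refl].
by apply: tm_reach_step; [reflexivity|rewrite /= rev_cons cat_rcons; exact: IHn].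
Qed.

Lemma odometer_erase D i r :
  tm_reach (Config (state Erase) (nseq i None) (map fresh D ++ r))
    (Config (state Erase) (nseq (i + size D) None) r).
Proof.
elim: D i => [|d D IHD] i; first by rewrite addn0; exact: tm_reach_refl.
apply: tm_reach_step; first reflexivity.
by rewrite addnS -addSn; exact: (IHD i.+1).
Qed.

Lemma odometer_computes (s : situation) n :
  tm_computes odometer (code_situation_nat (s, n))
    (code_nat (\prod_(x <- s) (radix x).+1)).
Proof.
pose D := map radix s ++ nseq n.+1 ord0.
have DE : (\prod_(r <- D) r.+1 = \prod_(x <- s) (radix x).+1)%N.
  rewrite big_cat big_map /= [X in (_ * X)%N]big1_seq ?muln1// => r /andP[_].
  by rewrite inE mem_nseq => /orP[/eqP->|/andP[_ /eqP->]].
rewrite -DE; set N := (\prod_(r <- D) _)%N.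
have N_gt0 : (0 < N)%N by apply: prodn_gt0.
suff [k runk] : tm_reach
    (Config (state ReadBits) [::] (on_tape odometer (code_situation_nat (s, n))))
    (Config (state Erase) (nseq (1 + size D) None) (nseq N mark)).
  (* The extra blank is the cell left of the input, reached by the borrow that overflows. *)
  exists k, (1 + size D)%N, 0%N, (state Erase); split.
    by rewrite cats0 /on_tape map_nseq.
  by rewrite cats0 /on_tape map_nseq -(prednK N_gt0).
rewrite /code_situation_nat /on_tape map_cat.
apply: tm_reach_trans (odometer_read_bits _ _ _) _; rewrite cats0.
apply: tm_reach_step; first reflexivity.
apply: tm_reach_trans (odometer_read_rest _ _) _.
have -> : rev (map fresh (nseq n ord0)) ++
    fresh ord0 :: rev (map fresh (map radix s)) = rev (map fresh D) ++ [::].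
  by rewrite cats0 /D map_cat rev_cat /= rev_cons cat_rcons.
(* The mark written at the end of the reading phase makes up for the failed last borrow:
   [1 + N.-1 = N]. *)
apply: tm_reach_trans (odometer_count D [::] 1) _.
apply: tm_reach_step; first reflexivity.
rewrite add1n prednK//.
exact: (odometer_erase D 1).
Qed.

End Odometer.

Lemma recursive_prod (c : bool -> nat) : (forall x, 0 < c x)%N ->
  recursive_situation_nat (fun s _ => \prod_(x <- s) c x)%N.
Proof.
move=> c_gt0.
pose radix x : 'I_(maxn (c true) (c false)).+1 := inord (c x).-1.
exists (odometer radix) => -[s n].
rewrite (eq_bigr (fun x => (radix x).+1)); first exact: odometer_computes.
move=> x _; rewrite inordK ?prednK//; apply: leqW.
by case: x; rewrite leq_max leqnn ?orbT.
Qed.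

Lemma meagre_sub (B : set outcome_path) (F : nat -> set outcome_path) :
  (forall k, nowhere_dense (F k)) -> B `<=` \bigcup_k F k -> meagre B.
Proof.
move=> Fnd BF; exists (fun k => B `&` F k).
  (* [meagre] asks for equality with the union, so each [F k] is cut down to [B]. *)
  move=> k s; have [t st Ft0] := Fnd k s; exists t => //.
  by rewrite -setIA Ft0 setI0.
by rewrite -setI_bigcupr; apply/esym/setIidPl.
Qed.

(** * The betting process and its growth along runs *)

Section BettingProcess.
Variables (R : realType) (y : bool) (K : nat).

Definition stake (x : bool) : nat := if x == y then K.+1 else 1%N.

Definition betting_process : real_process R :=
  fun s => (\prod_(x <- s) stake x)%:R / (\prod_(x <- s) K)%:R.

Hypothesis K_gt0 : (0 < K)%N.

Let stake_gt0 x : (0 < stake x)%N.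
Proof. by rewrite /stake; case: ifP. Qed.

Lemma betting_process_rcons s x :
  betting_process (rcons s x) = betting_process s * ((stake x)%:R / K%:R).
Proof.
by rewrite /betting_process -cats1 !big_cat !big_seq1 !natrM invfM mulrACA.
Qed.

Lemma betting_process_gt0 : positive_process betting_process.
Proof. by move=> s; rewrite divr_gt0// ltr0n prodn_gt0. Qed.

Lemma betting_process_test : test_process betting_process.
Proof.
split=> [s|]; first exact/ltW/betting_process_gt0.
by rewrite /betting_process !big_nil divr1.
Qed.

(** The values are rational, so the approximations can be exact and independent of the index. *)
Lemma betting_process_computable : computable_process betting_process.
Proof.
pose r (s : situation) (_ : nat) : rat :=
  (\prod_(x <- s) stake x)%:R / (\prod_(x <- s) K)%:R.
exists r, (fun _ _ => 0%N); split.
- exists (fun _ _ => 0%N), (fun s _ => \prod_(x <- s) stake x)%N,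
    (fun s _ => \prod_(x <- s) K)%N.
  split.
  + exact: recursive_situation_nat0.
  + exact: recursive_prod.
  + exact: recursive_prod.
  + by move=> s _; exact: prodn_gt0.
  + by move=> s n; rewrite expr0 mul1r.
- exact: recursive_situation_nat0.
- move=> s N n _; rewrite /r fmorph_div /= !ratr_nat subrr normr0.
  by rewrite invr_ge0 exprn_ge0.
Qed.

(** If [y] has probability q, the expected factor is q (1 + 1/K) + (1 - q)/K = q + 1/K, which the
    hypothesis bounds by 1. *)
Lemma betting_process_supermartingale (I : interval01 R) :
  (forall p, points I p -> (if y then p else 1 - p) * K%:R + 1 <= K%:R) ->
  supermartingale (stationary I) betting_process.
Proof.
move=> IK s; have [p Ip [-> _]] := upper_expectation_max I
  (process_difference betting_process s).
rewrite /process_difference !betting_process_rcons.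
have K0 : K%:R != 0 :> R by rewrite pnatr_eq0 -lt0n.
have -> : p * (betting_process s * ((stake true)%:R / K%:R) - betting_process s) +
    (1 - p) * (betting_process s * ((stake false)%:R / K%:R) - betting_process s) =
    betting_process s / K%:R * (((if y then p else 1 - p) * K%:R + 1) - K%:R).
  by rewrite /stake; case: (y) => /=; rewrite -natr1; field.
by rewrite mulr_ge0_le0 ?subr_le0 ?IK// divr_ge0// ltW// betting_process_gt0.
Qed.

Lemma betting_process_run s m :
  betting_process (s ++ nseq m y) = betting_process s * (1 + K%:R^-1) ^+ m.
Proof.
elim: m => [|m IHm]; first by rewrite cats0 expr0 mulr1.
have -> : s ++ nseq m.+1 y = rcons (s ++ nseq m y) y.
  by rewrite -cats1 -catA -addn1 nseqD.
rewrite betting_process_rcons IHm exprSr [RHS]mulrA; congr (_ * _).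
by rewrite /stake eqxx -(natr1 K) mulrDl mul1r divff// pnatr_eq0 -lt0n.
Qed.

(** Bernoulli's inequality alone gives linear growth along a run. Applied to both halves of a run of
    length 2l, it gives a quadratic bound, which beats [n + k]. *)
Lemma betting_process_nowhere_dense k :
  nowhere_dense [set omega | forall n, (k <= n)%N ->
                   betting_process (initial omega n) <= (n + k)%:R].
Proof.
move=> s.
pose d : R := K%:R^-1; have d_gt0 : 0 < d by rewrite invr_gt0 ltr0n.
pose e := betting_process s * d ^+ 2.
have e_gt0 : 0 < e by rewrite mulr_gt0 ?exprn_gt0 ?betting_process_gt0.
(* For l at least 1, [c * l] dominates [size s + (l + l) + k], the bound to be exceeded, while the
   capital is at least [e * l ^ 2]. *)
pose c := (size s + k + k + 2)%N.
have [l kl cel] : exists2 l : nat, (k < l)%N & c%:R < l%:R * e.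
  exists (k + Num.truncn (c%:R / e)).+1; first by rewrite ltnS leq_addr.
  rewrite -ltr_pdivrMr//; apply: lt_le_trans (truncnS_gt _) _.
  by rewrite ler_nat ltnS leq_addl.
have l_gt0 : (0 < l)%N := leq_ltn_trans (leq0n k) kl.
exists (s ++ nseq (l + l) y); first exact: prefix_prefix.
apply/seteqP; split=> // omega [/= grow] /= omegaE.
have := grow (size (s ++ nseq (l + l) y)).
rewrite omegaE betting_process_run size_cat size_nseq => /(_ _)/wrap[].
  by lia.
apply/negP; rewrite -ltNge.
apply: (@lt_le_trans _ _ (e * l%:R ^+ 2)).
  rewrite expr2 mulrA (mulrC e).
  apply: (@le_lt_trans _ _ (c%:R * l%:R)).
    by rewrite -natrM ler_nat /c; nia.
  by rewrite ltr_pM2r// ltr0n.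
rewrite /e -mulrA -exprMn ler_pM2l ?betting_process_gt0// exprD -expr2.
have bernoulli (j : nat) : 1 + d * j%:R <= (1 + d) ^+ j.
  elim: j => [|j IHj]; first by rewrite mulr0 addr0.
  rewrite exprSr -natr1.
  apply: (@le_trans _ _ ((1 + d * j%:R) * (1 + d))); last first.
    by rewrite ler_pM2r// addr_gt0.
  rewrite -subr_ge0 (_ : _ - _ = d ^+ 2 * j%:R); last by ring.
  by rewrite mulr_ge0// ltW// exprn_gt0.
apply: lerXn2r; rewrite ?nnegrE.
- by rewrite mulr_ge0// ltW.
- by rewrite exprn_ge0// addr_ge0// ltW.
- by apply: le_trans (bernoulli l); rewrite lerDr.
Qed.

End BettingProcess.

(** * Choice of the bet, and the two notions of randomness *)

Lemma unfavourable_outcome (R : realType) (I : interval01 R) :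
  points I `<` `[0 : R, 1 : R] ->
  exists y : bool, exists2 K : nat, (0 < K)%N &
    forall p, points I p -> (if y then p else 1 - p) * K%:R + 1 <= K%:R.
Proof.
move=> [_ IN01].
have [y [q q1 Iq]] : exists y : bool, exists2 q : R, q < 1 &
    forall p, points I p -> (if y then p else 1 - p) <= q.
  have [hi1|hi1] := ltP (hi I) 1.
    by exists true, (hi I) => // p; rewrite /points /= in_itv => /andP[].
  have [lo0|lo0] := ltP 0 (lo I).
    exists false, (1 - lo I); first by rewrite ltrBlDr ltrDl.
    by move=> p; rewrite /points /= in_itv => /andP[? _]; rewrite lerD2l lerN2.
  exfalso; apply: IN01 => p /=; rewrite /points /= !in_itv /= => /andP[p0 p1].
  by rewrite (le_trans lo0)// (le_trans p1).
(* [K] exceeds 1/(1 - q), which amounts to q K + 1 < K. *)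
exists y, (Num.truncn (1 - q)^-1).+1 => // p /Iq pq.
have := truncnS_gt (1 - q)^-1; set K := _%:R => qK.
have q1' : 0 < 1 - q by rewrite subr_gt0.
have K_ge0 : 0 <= K by exact: ler0n.
have pK : (if y then p else 1 - p) * K <= q * K by rewrite ler_wpM2r.
apply: le_trans (lerD pK (lexx 1)) _.
by rewrite -lerBrDl -{1}[K]mul1r -mulrBl -ler_pdivrMl// mulr1 ltW.
Qed.

(** The upper limit is the infimum of the suprema of the tails, so one of these suprema is below
    1. *)
Lemma limn_esup_le0_near (R : realType) (u : nat -> R) :
  (limn_esup (fun n => (u n)%:E) <= 0)%E ->
  exists k, forall n, (k <= n)%N -> u n <= 1.
Proof.
rewrite limn_esup_lim (cvg_lim _ (@cvg_esups_inf R (EFin \o u)))// => inf_le0.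
have /ereal_inf_lt[_ [k _ <-] uk] :=
  le_lt_trans inf_le0 (lte01 : (0 < 1 :> \bar R)%E).
exists k => n kn.
rewrite -lee_fin; apply: le_trans (ltW uk).
by apply: ereal_sup_ubound; exists n.
Qed.

Theorem theorem40 (R : realType) (I : interval01 R)
    (I_strict : points I `<` `[0 : R, 1 : R]) :
  (forall A : set (real_process R), allowable A ->
     meagre [set omega | allowably_random A (stationary I) omega]) /\
  meagre [set omega | schnorr_random (stationary I) omega].
Proof.
have [y [K K_gt0 IK]] := unfavourable_outcome I_strict.
pose T := betting_process R y K.
have T_supermartingale : test_supermartingale (stationary I) T.
  by split; [exact: betting_process_test|exact: betting_process_supermartingale].
have T_computable : computable_process T by exact: betting_process_computable.
split=> [A [_ _ /(_ T) AT]|];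
  apply: (meagre_sub (betting_process_nowhere_dense R y K_gt0)) => omega /=.
- have {}AT : A T.
    by apply: AT => //; [exact: betting_process_gt0|exact: betting_process_test].
  move=> /(_ T AT T_supermartingale)/= sup_lty.
  set S := [set _ | _ in _] in sup_lty.
  have [b supb] : exists b : R, (ereal_sup S <= b%:E)%E.
    case: (ereal_sup S) sup_lty => [b||]// _; first by exists b.
    by exists 0; rewrite leNye.
  (* This index exceeds [b], and being positive it forces [n > 0], as the supremum leaves out the
     empty prefix. *)
  exists (Num.truncn b).+1 => // n kn.
  have Tb : T (initial omega n) <= b.
    rewrite -lee_fin; apply: le_trans supb; apply: ereal_sup_ubound.
    by exists n => //=; exact: leq_trans kn.
  by rewrite (le_trans Tb)// (le_trans (ltW (truncnS_gt b)))// ler_nat leq_addl.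
- have id_growth : growth_function id.
    by split=> [|//|B]; [exact: recursive_nat_id|exists B.+1].
  move=> /(_ T id T_computable T_supermartingale id_growth).
  (* The successor absorbs the 1 in [T (initial omega n) - n <= 1]. *)
  move=> /limn_esup_le0_near[k Tk]; exists k.+1 => // n kn.
  have := Tk n (ltnW kn); rewrite lerBlDr => /le_trans; apply.
  by rewrite addrC natr1 ler_nat addnS ltnS leq_addr.
Qed.
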